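(* There exists a set $\mathcal{X}\subset\mathbb{R}^{14}$ of unit vectors spanning $|\mathcal{X}|=392$ biangular lines with $A(\mathcal{X})\subseteq\{\pm1/5,\pm3/5\}$.
   Context: For a finite set $\mathcal{X}\subset\mathbb{R}^d$ of unit vectors put $A(\mathcal{X}):=\{\langle x,x'\rangle\colon x\neq x';\ x,x'\in\mathcal{X}\}$. The set $\mathcal{X}$ spans a system of biangular lines (the lines through the origin in the directions $x\in\mathcal{X}$) if $-1\notin A(\mathcal{X})$ and $|\{\gamma^2\colon\gamma\in A(\mathcal{X})\}|\leq 2$. *)

(* Defs.v *)
From HB Require Import structures.
From mathcomp Require Import all_boot all_order all_algebra.
From mathcomp Require Import finmap reals.

Set Implicit Arguments.
Unset Strict Implicit.
Unset Printing Implicit Defensive.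

Import Order.TTheory GRing.Theory Num.Theory.
Local Open Scope ring_scope.
Local Open Scope fset_scope.

Section BiangularLines.
Variables (R : realType) (d : nat).
Implicit Types (x y : 'rV[R]_d) (X : {fset 'rV[R]_d}).

Definition inner x y : R := \sum_(i < d) x 0 i * y 0 i.

(* <x, x> = 1 says that the Euclidean norm of x is 1; the norm `|x| that the
   libraries put on row vectors is the sup norm. *)
Definition unit_vectors X : Prop := forall x, x \in X -> inner x x = 1.

Definition inner_products X : {fset R} :=
  [fset inner p.1 p.2 | p in [fset q in X `*` X | q.1 != q.2]].

(* -1 is excluded so that distinct vectors of X span distinct lines. *)
Definition spans_biangular_lines X : Prop :=
  [/\ unit_vectors X,
      -1 \notin inner_products X
    & (#|` [fset g ^+ 2 | g in inner_products X]| <= 2)%N].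

End BiangularLines.

(* Main.v *)
(* The 28 vectors w of norm^2 3 obtained by putting signs on the seven lines of
   the Fano plane, up to a global sign, have mutual inner products +-1, since
   two distinct lines meet in one point.  With e_j the standard basis of R^7,
   the 28 * 14 vectors (w, +- sqrt 2 e_j) / sqrt 5 of R^14 have norm 1, and
   their inner products are (<w, w'> + 2 b) / 5 with b = 0, 1 or -1, where
   b <> 1 if w = w' and the vectors differ.  (These are, up to scaling and sign, the vectors of norm
   5/2 in a coset of the lattice E7 + D7.) *)
Require Import Defs.
From mathcomp Require Import all_boot all_order all_algebra.
From mathcomp Require Import finmap reals.
From mathcomp Require Import ring lra.

Import Order.TTheory GRing.Theory Num.Theory.
Local Open Scope ring_scope.

(* The lines of the Fano plane are the translates {l, l + 1, l + 3} mod 7; the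
   sign at l is normalised to 1. *)
Definition fano_vec (l : nat) (a b : bool) (i : nat) : int :=
  if i == l then 1
  else if i == ((l + 1) %% 7)%N then (if a then -1 else 1)
  else if i == ((l + 3) %% 7)%N then (if b then -1 else 1)
  else 0.

Definition axis_vec (j : nat) (c : bool) (i : nat) : int :=
  if i == j then (if c then -1 else 1) else 0.

(** A fold over an explicit list reduces under [vm_compute], whereas the big operator is locked;
    [dot7E] translates between the two. *)
Definition dot7 (u v : nat -> int) : int :=
  foldr (fun i s => u i * v i + s) 0 (iota 0 7).

Lemma dot7E (u v : nat -> int) : \sum_(i < 7) u i * v i = dot7 u v.
Proof.
by rewrite -(big_mkord xpredT (fun i => u i * v i)) unlock.
Qed.

(** Distinct Fano lines share one point, giving 1 or -1. On a common line, two different sign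
    patterns with first sign 1 differ in one or two places, giving 3 - 2 or 3 - 4. *)
Lemma fano_vec_dot (l l' : 'I_7) (a b a' b' : bool) :
  let z := dot7 (fano_vec l a b) (fano_vec l' a' b') in
  if (l, a, b) == (l', a', b') then z = 3 else z \in [:: 1; -1].
Proof.
pose bs := [:: true; false].
(* Indices in [nat] and explicit lists turn the finite check into a closed boolean that evaluates
   without ordinals. *)
pose chk (l l' : nat) a b a' b' :=
  let z := dot7 (fano_vec l a b) (fano_vec l' a' b') in
  if [&& l == l', a == a' & b == b'] then z == 3 else z \in [:: 1; -1].
have /allP H : all (fun l => all (fun l' => all (fun a => all (fun b =>
    all (fun a' => all (chk l l' a b a') bs) bs) bs) bs) (iota 0 7)) (iota 0 7).
  by vm_compute.
have inb c : c \in bs by case: c.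
have ino (i : 'I_7) : (i : nat) \in iota 0 7 by rewrite mem_iota ltn_ord.
move: (H _ (ino l)) => /allP/(_ _ (ino l'))/allP/(_ _ (inb a)).
move=> /allP/(_ _ (inb b))/allP/(_ _ (inb a'))/allP/(_ _ (inb b')).
by rewrite /chk !xpair_eqE -andbA; case: ifP => // _ /eqP.
Qed.

Lemma axis_vec_dot (j j' : 'I_7) (c c' : bool) :
  let z := dot7 (axis_vec j c) (axis_vec j' c') in
  if (j, c) == (j', c') then z = 1 else z \in [:: 0; -1].
Proof.
pose bs := [:: true; false].
pose chk (j j' : nat) c c' :=
  let z := dot7 (axis_vec j c) (axis_vec j' c') in
  if (j == j') && (c == c') then z == 1 else z \in [:: 0; -1].
have /allP H : all (fun j => all (fun j' => all (fun c =>
    all (chk j j' c) bs) bs) (iota 0 7)) (iota 0 7).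
  by vm_compute.
have inb d : d \in bs by case: d.
have ino (i : 'I_7) : (i : nat) \in iota 0 7 by rewrite mem_iota ltn_ord.
move: (H _ (ino j)) => /allP/(_ _ (ino j'))/allP/(_ _ (inb c)).
move=> /allP/(_ _ (inb c')).
by rewrite /chk !xpair_eqE; case: ifP => // _ /eqP.
Qed.

Definition line_index : finType :=
  (('I_7 * bool * bool) * ('I_7 * bool))%type.

Lemma card_line_index : #|line_index| = 392%N.
Proof. by rewrite !card_prod !card_ord !card_bool. Qed.

Definition fano_dot (p q : line_index) : int :=
  dot7 (fano_vec p.1.1.1 p.1.1.2 p.1.2) (fano_vec q.1.1.1 q.1.1.2 q.1.2).

Definition axis_dot (p q : line_index) : int :=
  dot7 (axis_vec p.2.1 p.2.2) (axis_vec q.2.1 q.2.2).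

Lemma inner_row_mx (R : realType) (m n : nat) (u u' : 'rV[R]_m)
    (v v' : 'rV[R]_n) :
  inner (row_mx u v) (row_mx u' v') = inner u u' + inner v v'.
Proof.
rewrite /inner big_split_ord.
by congr (_ + _); apply: eq_bigr => i _; rewrite ?row_mxEl ?row_mxEr.
Qed.

Section LineVectors.
Variable R : realType.

Definition line_vec (p : line_index) : 'rV[R]_14 :=
  row_mx
    (\row_(i < 7) ((fano_vec p.1.1.1 p.1.1.2 p.1.2 i)%:~R / Num.sqrt 5))
    (\row_(i < 7) ((axis_vec p.2.1 p.2.2 i)%:~R * Num.sqrt 2 / Num.sqrt 5))
  : 'rV[R]_(7 + 7).

Lemma inner_line_vec (p q : line_index) :
  inner (line_vec p) (line_vec q)
    = ((fano_dot p q)%:~R + 2 * (axis_dot p q)%:~R) / 5.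
Proof.
have s5 : Num.sqrt 5 * Num.sqrt 5 = 5 :> R by rewrite -expr2 sqr_sqrtr.
have s2 : Num.sqrt 2 * Num.sqrt 2 = 2 :> R by rewrite -expr2 sqr_sqrtr.
(* The block sizes are explicit because 14 matches [7 + 7] only by conversion. *)
rewrite (@inner_row_mx R 7 7) /inner /fano_dot /axis_dot -!dot7E.
rewrite !rmorph_sum /= mulrDl mulr_sumr !mulr_suml.
congr (_ + _); apply: eq_bigr => i _; rewrite !mxE rmorphM /=.
  by rewrite mulrACA -invfM s5.
by rewrite mulrACA -invfM s5 mulrACA s2; congr (_ / _); exact: mulrC.
Qed.

Lemma inner_line_vec_same (p : line_index) :
  inner (line_vec p) (line_vec p) = 1.
Proof.
rewrite inner_line_vec.
case: p => [[[l a] b] [j c]]; rewrite /fano_dot /axis_dot /=.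
have := fano_vec_dot l l a b a b; have := axis_vec_dot j j c c.
by rewrite !eqxx => -> ->; lra.
Qed.

(** With z and b the Fano and axis products, z + 2b is odd and lies between -3 and 3, except that z
    = 3, b = 1 gives 5; that pair forces p = q. *)
Lemma inner_line_vec_neq (p q : line_index) : p != q ->
  inner (line_vec p) (line_vec q)
    \in [fset 1 / 5; - (1 / 5); 3 / 5; - (3 / 5)]%fset.
Proof.
rewrite inner_line_vec !inE.
case: p q => [[[l a] b] [j c]] [[[l' a'] b'] [j' c']].
rewrite /fano_dot /axis_dot [_ == _]xpair_eqE /=.
have := fano_vec_dot l l' a b a' b'; have := axis_vec_dot j j' c c'.
move=> /=; rewrite !inE -!orbA.
(* The axis product is split first, then the Fano product; when both index parts agree, [//] closes
   the case by [p != q]. *)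
case: ifP => _; [move=> -> | case/orP => /eqP ->];
  (case: ifP => _; [move=> -> | case/orP => /eqP ->]) => // _;
  apply/or4P.
all: solve [ apply: Or41; apply/eqP; lra | apply: Or42; apply/eqP; lra
           | apply: Or43; apply/eqP; lra | apply: Or44; apply/eqP; lra ].
Qed.

(** A collision between distinct indices would put the squared norm 1 among the four values 1/5,
    -1/5, 3/5, -3/5. *)
Lemma line_vec_inj : injective line_vec.
Proof.
move=> p q eq_pq; apply/eqP; apply: contraT => /inner_line_vec_neq.
rewrite eq_pq inner_line_vec_same !inE -!orbA.
by case/or4P => /eqP; lra.
Qed.

End LineVectors.

Local Open Scope fset_scope.

Theorem corollary2p12 (R : realType) :
  exists X : {fset 'rV[R]_14},
    [/\ spans_biangular_lines X,
        #|` X| = 392%N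
      & inner_products X `<=` [fset 1 / 5; - (1 / 5); 3 / 5; - (3 / 5)]].
Proof.
pose X : {fset 'rV[R]_14} := [fset line_vec R p | p in line_index].
have sub : inner_products X `<=` [fset 1 / 5; - (1 / 5); 3 / 5; - (3 / 5)].
  apply/fsubsetP => _ /imfsetP[[x y] /= xyP ->].
  rewrite !inE /= in xyP; case/andP: xyP => /andP[].
  move=> /imfsetP[p _ ->] /imfsetP[q _ ->] neq.
  by apply: inner_line_vec_neq; apply: contraNneq neq => ->.
exists X; split => //; last first.
  rewrite card_imfset /=; last exact: line_vec_inj.
  by rewrite -cardE card_line_index.
split.
- by move=> _ /imfsetP[p _ ->]; exact: inner_line_vec_same.
- apply/negP => /(fsubsetP sub); rewrite !inE -!orbA.
  by case/or4P => /eqP; lra.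
- have sq : [fset g ^+ 2 | g in inner_products X] `<=` [fset 1 / 25; 9 / 25 : R].
    apply/fsubsetP => _ /imfsetP[g /= /(fsubsetP sub) gP ->].
    move: gP; rewrite !inE -!orbA => /or4P[] /eqP ->; apply/orP;
      by [left; apply/eqP; field | right; apply/eqP; field].
  apply: leq_trans (fsubset_leq_card sq) _.
  by rewrite cardfs2; case: (_ != _).
Qed.
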